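(* Let $q$ be a power of an odd prime $p$ and $K$ an algebraic closure of $\mathbb{F}_q$. Let $\mathrm{PGL}(2,q)$ denote the subgroup of $\mathrm{PGL}(3,q)$ generated by $\tau:(X,Y,Z)\mapsto(Z,Y,X)$, $\sigma_a:(X,Y,Z)\mapsto(X+aY+\tfrac12a^2Z,\,Y+aZ,\,Z)$ for $a\in\mathbb{F}_q$, and $\delta_b:(X,Y,Z)\mapsto(b^2X,bY,Z)$ for $b\in\mathbb{F}_q^*$, acting on $\mathrm{PG}(2,K)$. Then $d(\mathrm{PGL}(2,q))=2$, $\varepsilon(\mathrm{PGL}(2,q))=q-1$, and the irreducible conic $Y^2-2XZ=0$ is the unique $\mathrm{PGL}(2,q)$-invariant irreducible plane curve of degree smaller than $q+1$.
   Context: This group is the stabilizer in $\mathrm{PGL}(3,q)$ of the conic $Y^2-2XZ=0$. Plane curves are over $K$; irreducible means irreducible over $K$; $G$-invariant means mapped onto itself by every element of $G$. $d(G)$ is the smallest degree of a $G$-invariant irreducible plane curve other than a line; $\varepsilon(G)=d'(G)-d(G)$ where $d'(G)$ is the smallest degree larger than $d(G)$ of a $G$-invariant irreducible plane curve. *)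

(* Defs.v *)
From HB Require Import structures.
From mathcomp Require Import all_boot all_order all_algebra.
From mathcomp Require Import mpoly.
Set Implicit Arguments. Unset Strict Implicit. Unset Printing Implicit Defensive.
Import Order.TTheory GRing.Theory.
Local Open Scope ring_scope.

Section PlaneCurves.
Variable K : fieldType.

Definition Xv : {mpoly K[3]} := 'X_(0 : 'I_3).
Definition Yv : {mpoly K[3]} := 'X_(1 : 'I_3).
Definition Zv : {mpoly K[3]} := 'X_(2 : 'I_3).

Definition mconst (F : {mpoly K[3]}) := exists c : K, F = c%:MP.

Definition mirreducible (F : {mpoly K[3]}) :=
  ~ mconst F /\
  forall G H : {mpoly K[3]}, F = G * H -> mconst G \/ mconst H.

(* A plane curve of degree d is (given by) a nonzero homogeneous form of
   degree d in K[X,Y,Z], considered up to a nonzero scalar. *)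
Definition is_form_of_degree (d : nat) (F : {mpoly K[3]}) :=
  F != 0 /\ F \is d.-homog.

Definition msubst (M : 'M[K]_3) (F : {mpoly K[3]}) : {mpoly K[3]} :=
  F \mPo [tuple \sum_(j < 3) M i j *: 'X_j | i < 3].

Definition curve_invariant_by (M : 'M[K]_3) (F : {mpoly K[3]}) :=
  exists2 c : K, c != 0 & msubst M F = c *: F.

Definition tau_mx : 'M[K]_3 :=
  \matrix_(i < 3, j < 3) (if (i : nat) + j == 2 then 1 else 0).
Definition sigma_mx (a : K) : 'M[K]_3 :=
  \matrix_(i < 3, j < 3)
    (if i == j then 1
     else if ((i : nat) == 0) && ((j : nat) == 1) then a
     else if ((i : nat) == 1) && ((j : nat) == 2) then a
     else if ((i : nat) == 0) && ((j : nat) == 2) then a ^+ 2 / 2%:R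
     else 0).
Definition delta_mx (b : K) : 'M[K]_3 :=
  \matrix_(i < 3, j < 3)
    (if i == j then
       (if (i : nat) == 0 then b ^+ 2 else if (i : nat) == 1 then b else 1)
     else 0).

(* The subgroup of PGL(3,q) generated by tau, sigma_a (a in F_q),
   delta_b (b nonzero in F_q), as a set of representing matrices; F_q is the
   subfield {x | x^q = x} of K. *)
Inductive in_PGL2 (q : nat) : 'M[K]_3 -> Prop :=
  | PGL2_one : in_PGL2 q 1%:M
  | PGL2_tau : in_PGL2 q tau_mx
  | PGL2_sigma a : a ^+ q = a -> in_PGL2 q (sigma_mx a)
  | PGL2_delta b : b ^+ q = b -> b != 0 -> in_PGL2 q (delta_mx b)
  | PGL2_mul M N : in_PGL2 q M -> in_PGL2 q N -> in_PGL2 q (M *m N).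

Definition G_invariant (G : 'M[K]_3 -> Prop) (F : {mpoly K[3]}) :=
  forall M, G M -> curve_invariant_by M F.

Definition has_inv_irr_curve (G : 'M[K]_3 -> Prop) (n : nat) :=
  exists F, [/\ is_form_of_degree n F, mirreducible F & G_invariant G F].

Definition d_of (G : 'M[K]_3 -> Prop) (n : nat) :=
  [/\ n != 1%N, has_inv_irr_curve G n &
      forall m, (m < n)%N -> m != 1%N -> ~ has_inv_irr_curve G m].

Definition d'_of (G : 'M[K]_3 -> Prop) (n n' : nat) :=
  [/\ (n < n')%N, has_inv_irr_curve G n' &
      forall m, (n < m < n')%N -> ~ has_inv_irr_curve G m].

Definition eps_of (G : 'M[K]_3 -> Prop) (e : nat) :=
  exists n n', [/\ d_of G n, d'_of G n n' & e = (n' - n)%N].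

End PlaneCurves.

(* Main.v *)
(** Let [F] be an invariant irreducible form of degree [d <= q].  Its restriction
    to the tangent line [Z = 0] of the conic at [(1 : 0 : 0)] is a polynomial of
    degree at most [d] whose set of roots is stable under translations by [F_q].
    If that degree is less than [q], the restriction is a multiple of [Y ^ d],
    nonzero because [Z] does not divide [F].  Semi-invariance under the diagonal
    group then leaves only the monomials [Y ^ j (X Z) ^ i], so [F] splits into
    factors [Y] and [Y ^ 2 - l X Z]; invariance under [sigma_1] forces [l = 2].
    Degree [q] is possible only for [q = 3] and [d = 3], where [X - Z] divides [F].

    In degree [q + 1], the form [Y ^ (q + 1) - X Z ^ q - X ^ q Z] is invariant,
    and it is irreducible by Eisenstein's criterion at [X]. *)

Require Import Defs.
From HB Require Import structures.
From mathcomp Require Import all_boot all_order all_algebra.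
From mathcomp Require Import separable mpoly ring zify.
Set Implicit Arguments. Unset Strict Implicit. Unset Printing Implicit Defensive.
Import GRing.Theory.
Local Open Scope ring_scope.

(** * Monomials in three variables *)

Definition mon (i j k : nat) : 'X_{1..3} := [multinom nth 0%N [:: i; j; k] l | l < 3].

Lemma ord3P (P : 'I_3 -> Prop) : P 0 -> P 1 -> P 2 -> forall i, P i.
Proof.
move=> P0 P1 P2 [[|[|[|//]]] lti].
- by rewrite (_ : Ordinal lti = 0) //; apply: val_inj.
- by rewrite (_ : Ordinal lti = 1) //; apply: val_inj.
- by rewrite (_ : Ordinal lti = 2) //; apply: val_inj.
Qed.

Lemma mon_eta (m : 'X_{1..3}) : m = mon (m 0) (m 1) (m 2).
Proof. by apply/mnmP; apply: ord3P; rewrite mnmE. Qed.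

Lemma mon0 i j k : mon i j k 0 = i. Proof. by rewrite mnmE. Qed.
Lemma mon1 i j k : mon i j k 1 = j. Proof. by rewrite mnmE. Qed.
Lemma mon2 i j k : mon i j k 2 = k. Proof. by rewrite mnmE. Qed.

Lemma mon_eqE (m : 'X_{1..3}) i j k :
  (m == mon i j k) = [&& m 0 == i, m 1 == j & m 2 == k].
Proof.
apply/eqP/and3P => [->|[/eqP<- /eqP<- /eqP<-]]; last exact: mon_eta.
by rewrite mon0 mon1 mon2.
Qed.

Lemma big_ord3 (V : Type) (idx : V) (op : Monoid.law idx) (f : 'I_3 -> V) :
  \big[op/idx]_(i < 3) f i = op (f 0) (op (f 1) (f 2)).
Proof.
rewrite !big_ord_recl big_ord0 Monoid.mulm1.
by congr (op (f _) (op (f _) (f _))); apply: val_inj.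
Qed.

Lemma mdeg3 (m : 'X_{1..3}) : mdeg m = (m 0%R + m 1%R + m 2%R)%N.
Proof. by rewrite mdegE big_ord3 /= addnA. Qed.

(** * Ternary forms: evaluation, restriction to the tangent line, linear substitutions *)

Section Forms.
Variable K : fieldType.
Implicit Types (F G H : {mpoly K[3]}) (x y z : K) (M N : 'M[K]_3).

Notation X := (Xv K). Notation Y := (Yv K). Notation Z := (Zv K).

Lemma mpolyX3 (m : 'X_{1..3}) : 'X_[m] = X ^+ m 0 * Y ^+ m 1 * Z ^+ m 2.
Proof. by rewrite mpolyXE_id big_ord3 /= mulrA. Qed.

Lemma mpolyX_mon i j k : 'X_[mon i j k] = X ^+ i * Y ^+ j * Z ^+ k.
Proof. by rewrite mpolyX3 mon0 mon1 mon2. Qed.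

Definition pt x y z : 'I_3 -> K := fun i => nth 0 [:: x; y; z] i.

Lemma meval_pt F x y z :
  F.@[pt x y z] = \sum_(m <- msupp F) F@_m * (x ^+ m 0 * y ^+ m 1 * z ^+ m 2).
Proof.
rewrite mevalE; apply: eq_bigr => m _; congr (_ * _).
by rewrite big_ord3 /= mulrA.
Qed.

(** When [m0] lies outside the support, both sides vanish. *)
Lemma big_msupp1 F (phi : 'X_{1..3} -> K) m0 :
  (forall m, m \in msupp F -> m != m0 -> phi m = 0) ->
  \sum_(m <- msupp F) F@_m * phi m = F@_m0 * phi m0.
Proof.
move=> phi0; have [m0F|m0F] := boolP (m0 \in msupp F).
  rewrite (bigD1_seq m0) ?msupp_uniq //= big_seq_cond big1 ?addr0 // => m.
  by case/andP=> mF nm; rewrite phi0 ?mulr0.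
rewrite big_seq big1 => [|m mF]; last first.
  by rewrite phi0 ?mulr0 //; apply: contraNneq m0F => <-.
by move: m0F; rewrite -mcoeff_eq0 => /eqP ->; rewrite mul0r.
Qed.

Lemma homog_deg d F m : F \is d.-homog -> m \in msupp F -> (m 0%R + m 1%R + m 2%R)%N = d.
Proof. by move=> /dhomogP homF /homF; rewrite -mdeg3. Qed.

Lemma meval_Z d F : F \is d.-homog -> F.@[pt 0 0 1] = F@_(mon 0 0 d).
Proof.
move=> homF; rewrite meval_pt (big_msupp1 (m0 := mon 0 0 d)).
  by rewrite mon0 mon1 mon2 expr1n !expr0 !mulr1.
move=> m /(homog_deg homF) dm; rewrite mon_eqE => nm; rewrite !expr0n.
by case: eqP => m1; case: eqP => m2; rewrite ?mulr0 ?mul0r //; lia.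
Qed.

Lemma meval_scale d F c x y z : F \is d.-homog ->
  F.@[pt (c * x) (c * y) (c * z)] = c ^+ d * F.@[pt x y z].
Proof.
move=> homF; rewrite !meval_pt mulr_sumr big_seq [RHS]big_seq.
apply: eq_bigr => m /(homog_deg homF) <-; rewrite !exprMn !exprD; ring.
Qed.

(** Dehomogenizing at [Y = 1] makes [sigma_a] act on the line [Z = 0] as the translation by [a]. *)
Definition tangent d F : {poly K} := \poly_(i < d.+1) F@_(mon i (d - i) 0).

Lemma tangentE d F x : F \is d.-homog -> (tangent d F).[x] = F.@[pt x 1 0].
Proof.
move=> homF; rewrite meval_pt horner_poly.
(* An indicator spreads each term over the indices [i], so that the two sums can be exchanged; terms
   containing [Z] contribute zero. *)
have E m : m \in msupp F -> F@_m * (x ^+ m 0 * 1 ^+ m 1 * 0 ^+ m 2) =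
    \sum_(i < d.+1) F@_m * (m == mon i (d - i) 0)%:R * x ^+ i.
  move=> /(homog_deg homF) dm; have lt_md : (m 0%R < d.+1)%N by lia.
  rewrite (bigD1 (Ordinal lt_md)) //= big1 ?addr0 => [|i neq_i].
    rewrite mon_eqE eqxx expr1n expr0n /= mulr1.
    case: eqP => m2; rewrite ?andbF /= ?mulr0 ?mul0r // -dm m2.
    by rewrite (_ : (_ == _) = true) /= ?mulr1 //; apply/eqP; lia.
  rewrite mon_eqE; case: eqP => [mi|]; rewrite ?mulr0 ?mul0r //.
  by case/eqP: neq_i; apply: val_inj.
under [RHS]eq_big_seq => m mF do rewrite E //.
rewrite exchange_big /=; apply: eq_bigr => i _.
rewrite -mulr_suml; congr (_ * _); rewrite (big_msupp1 (m0 := mon i (d - i) 0)).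
  by rewrite eqxx mulr1.
by move=> m _ /negPf ->.
Qed.

Lemma mvar_dvd F (l : 'I_3) :
  (forall m, m \in msupp F -> (0 < m l)%N) -> exists G, F = 'X_l * G.
Proof.
move=> posF; exists (\sum_(m <- msupp F) F@_m *: 'X_[(m - U_(l))%MM]).
rewrite mulr_sumr [LHS]mpolyE big_seq [RHS]big_seq; apply: eq_bigr => m mF.
rewrite -scalerAr -mpolyXD addmC submK //.
by apply/mnm_lepP => i; rewrite mnm1E; case: eqP => [<-|] //; rewrite posF.
Qed.

Lemma meval_msubst M F v :
  (msubst M F).@[v] = F.@[fun i => \sum_j M i j * v j].
Proof.
rewrite comp_mpoly_meval; apply: meval_eq => i; rewrite tnth_mktuple.
rewrite (raddf_sum (meval v)); apply: eq_bigr => j _.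
by rewrite /= mevalZ mevalXU.
Qed.

(** Evaluating [F] at [M (N v)] amounts to substituting [M] first and [N] afterwards. *)
Lemma msubstM M N F : msubst (M *m N) F = msubst N (msubst M F).
Proof.
rewrite /msubst (comp_mpolyEX F) (comp_mpolyEX F) raddf_sum; apply: eq_bigr => m _.
rewrite /= comp_mpolyZ; congr (_ *: _); rewrite !comp_mpolyX rmorph_prod.
apply: eq_bigr => i _; rewrite rmorphXn /= !tnth_mktuple; congr (_ ^+ _).
rewrite raddf_sum /=.
under [RHS]eq_bigr => j _ do
  rewrite comp_mpolyZ comp_mpolyXU -tnth_nth tnth_mktuple scaler_sumr.
rewrite exchange_big /=; apply: eq_bigr => k _; rewrite mxE scaler_suml.
by apply: eq_bigr => j _; rewrite scalerA.
Qed.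

Lemma msubst1 F : msubst 1%:M F = F.
Proof.
rewrite -[RHS]comp_mpoly_id; congr (comp_mpoly _ F).
apply: eq_from_tnth => i; rewrite !tnth_mktuple (bigD1 i) //= big1.
  by rewrite mxE eqxx scale1r addr0.
by move=> j ne_ji; rewrite mxE eq_sym (negPf ne_ji) scale0r.
Qed.

Lemma msubst_var M (i : 'I_3) : msubst M 'X_i = \sum_(j < 3) M i j *: 'X_j.
Proof. by rewrite /msubst comp_mpolyXU -tnth_nth tnth_mktuple. Qed.

Lemma meval_tau F x y z : (msubst (tau_mx K) F).@[pt x y z] = F.@[pt z y x].
Proof.
rewrite meval_msubst; apply: meval_eq.
by apply: ord3P; rewrite big_ord3 !mxE /= /pt /=; ring.
Qed.

Lemma meval_sigma a F x y z : (msubst (sigma_mx a) F).@[pt x y z] =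
  F.@[pt (x + a * y + a ^+ 2 / 2%:R * z) (y + a * z) z].
Proof.
rewrite meval_msubst; apply: meval_eq.
by apply: ord3P; rewrite big_ord3 !mxE /= /pt /=; ring.
Qed.

Lemma meval_delta b F x y z :
  (msubst (Defs.delta_mx b) F).@[pt x y z] = F.@[pt (b ^+ 2 * x) (b * y) z].
Proof.
rewrite meval_msubst; apply: meval_eq.
by apply: ord3P; rewrite big_ord3 !mxE /= /pt /=; ring.
Qed.

Lemma msubst_vars M : [/\
  msubst M X = M 0 0 *: X + (M 0 1 *: Y + M 0 2 *: Z),
  msubst M Y = M 1 0 *: X + (M 1 1 *: Y + M 1 2 *: Z) &
  msubst M Z = M 2 0 *: X + (M 2 1 *: Y + M 2 2 *: Z)].
Proof. by split; rewrite msubst_var big_ord3. Qed.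

Lemma msubst_tau_vars : [/\ msubst (tau_mx K) X = Z,
  msubst (tau_mx K) Y = Y & msubst (tau_mx K) Z = X].
Proof.
have [-> -> ->] := msubst_vars (tau_mx K).
by rewrite !mxE /= !scale0r !scale1r !add0r !addr0.
Qed.

Lemma msubst_sigma_vars a : [/\
  msubst (sigma_mx a) X = X + (a *: Y + (a ^+ 2 / 2%:R) *: Z),
  msubst (sigma_mx a) Y = Y + a *: Z & msubst (sigma_mx a) Z = Z].
Proof.
have [-> -> ->] := msubst_vars (sigma_mx a).
by rewrite !mxE /= !scale0r !scale1r !add0r.
Qed.

Lemma msubst_delta_vars b : [/\
  msubst (Defs.delta_mx b) X = b ^+ 2 *: X,
  msubst (Defs.delta_mx b) Y = b *: Y & msubst (Defs.delta_mx b) Z = Z].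
Proof.
have [-> -> ->] := msubst_vars (Defs.delta_mx b).
by rewrite !mxE /= !scale0r !scale1r !add0r !addr0.
Qed.

HB.instance Definition _ M :=
  GRing.RMorphism.copy (msubst M) (comp_mpoly [tuple \sum_(j < 3) M i j *: 'X_j | i < 3]).

Lemma msubstZ M c F : msubst M (c *: F) = c *: msubst M F.
Proof. exact: comp_mpolyZ. Qed.

(** Meant for [delta_b] and [tau], which send distinct monomials to multiples of distinct monomials:
    each coefficient has a single source. *)
Lemma mcoeff_big_inj F (c : 'X_{1..3} -> K) (g : 'X_{1..3} -> 'X_{1..3}) m0 :
  injective g ->
  (\sum_(m <- msupp F) F@_m *: (c m *: 'X_[g m]))@_(g m0) = F@_m0 * c m0.
Proof.
move=> inj_g; rewrite raddf_sum /=.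
under eq_bigr => m _ do rewrite !mcoeffZ mcoeffX (inj_eq inj_g).
rewrite (big_msupp1 (m0 := m0)) ?eqxx ?mulr1 // => m _ /negPf ->.
by rewrite mulr0.
Qed.

Lemma msubst_msupp M F : msubst M F = \sum_(m <- msupp F)
  F@_m *: (msubst M X ^+ m 0 * msubst M Y ^+ m 1 * msubst M Z ^+ m 2).
Proof.
rewrite {1}(mpolyE F) rmorph_sum; apply: eq_bigr => m _ /=.
by rewrite msubstZ mpolyX3 !rmorphM !rmorphXn.
Qed.

Lemma mcoeff_delta b F m :
  (msubst (Defs.delta_mx b) F)@_m = b ^+ (m 0%R).*2 * b ^+ m 1 * F@_m.
Proof.
rewrite msubst_msupp; have [-> -> ->] := msubst_delta_vars b.
rewrite mulrC -(mcoeff_big_inj F (fun m => b ^+ (m 0%R).*2 * b ^+ m 1) m (@inj_id _)).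
congr (_@_m); apply: eq_bigr => m' _; rewrite mpolyX3 !exprZn -exprM mul2n.
rewrite -scalerAr -!scalerAl !scalerA; congr (_ *: _); ring.
Qed.

Lemma mcoeff_tau F i j k : (msubst (tau_mx K) F)@_(mon i j k) = F@_(mon k j i).
Proof.
rewrite msubst_msupp; have [-> -> ->] := msubst_tau_vars.
pose g (m : 'X_{1..3}) := mon (m 2) (m 1) (m 0).
have inj_g : injective g.
  by apply: (can_inj (g := g)) => m; rewrite /g !(mon0, mon1, mon2) -mon_eta.
have -> : mon i j k = g (mon k j i) by rewrite /g !(mon0, mon1, mon2).
rewrite -[RHS]mulr1 -(mcoeff_big_inj F (fun=> 1) _ inj_g).
congr (_@__); apply: eq_bigr => m' _.
by rewrite scale1r mpolyX_mon; congr (_ *: _); ring.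
Qed.

(** Modulo [X - Z], [tau] is the identity on the variables, hence on all polynomials. *)
Lemma msubst_tau_sub F : exists H, msubst (tau_mx K) F - F = (X - Z) * H.
Proof.
pose D F := exists H, msubst (tau_mx K) F - F = (X - Z) * H.
have DM F1 F2 : D F1 -> D F2 -> D (F1 * F2).
  move=> [H1 e1] [H2 e2]; exists (msubst (tau_mx K) F1 * H2 + H1 * F2).
  rewrite rmorphM /= mulrDr mulrCA -e2 mulrA -e1; ring.
have D1 : D 1 by exists 0; rewrite rmorph1 mulr0 subrr.
have DX F1 n : D F1 -> D (F1 ^+ n).
  by move=> DF; elim: n => [|n IH]; rewrite ?expr0 // exprS; apply: DM.
have [tX tY tZ] := msubst_tau_vars.
elim/mpolyind: F => [|c m F _ _ [H eH]].
  by exists 0; rewrite mulr0 rmorph0 subrr.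
have [H' eH'] : D 'X_[m].
  rewrite mpolyX3; apply: (DM); first apply: (DM); apply: (DX).
  - by exists (-1); rewrite tX; ring.
  - by exists 0; rewrite tY; ring.
  - by exists 1; rewrite tZ; ring.
exists (c *: H' + H); rewrite rmorphD /= msubstZ.
by rewrite opprD addrACA eH -scalerBr eH' scalerAr mulrDr.
Qed.

End Forms.

(** * Irreducibility through Eisenstein's criterion *)

Section Irreducibility.
Variable K : fieldType.
Implicit Types (F G H : {mpoly K[3]}).

Notation X := (Xv K). Notation Y := (Yv K). Notation Z := (Zv K).

Definition iterC (c : K) : {poly {poly {poly K}}} := c%:P%:P%:P.

Fact iterC_is_zmod_morphism : zmod_morphism iterC.
Proof. by move=> a b; rewrite /iterC !polyCB. Qed.
Fact iterC_is_monoid_morphism : monoid_morphism iterC.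
Proof. by split=> [|a b]; rewrite /iterC ?polyC1 // !polyCM. Qed.
HB.instance Definition _ := GRing.isZmodMorphism.Build _ _ iterC iterC_is_zmod_morphism.
HB.instance Definition _ := GRing.isMonoidMorphism.Build _ _ iterC iterC_is_monoid_morphism.

(** The nesting is [K[Z][X][Y]]: the curves are monic in the outer variable [Y], and [X] is the
    prime of [K[Z][X]] at which Eisenstein's criterion applies. *)
Definition itervar : 'I_3 -> {poly {poly {poly K}}} :=
  fun l => nth 0 [:: 'X%:P; 'X; 'X%:P%:P] l.

Definition iterpoly F := mmap iterC itervar F.

Fact iterpoly_is_zmod_morphism : zmod_morphism iterpoly.
Proof. exact: mmap_is_additive. Qed.
Fact iterpoly_is_monoid_morphism : monoid_morphism iterpoly.
Proof. by have [e1 eM] := mmap_is_multiplicative itervar iterC; split. Qed.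
HB.instance Definition _ :=
  GRing.isZmodMorphism.Build _ _ iterpoly iterpoly_is_zmod_morphism.
HB.instance Definition _ :=
  GRing.isMonoidMorphism.Build _ _ iterpoly iterpoly_is_monoid_morphism.

Lemma iterpoly_vars : [/\ iterpoly X = 'X%:P, iterpoly Y = 'X & iterpoly Z = 'X%:P%:P].
Proof. by rewrite /iterpoly /Xv /Yv /Zv !mmapX !mmap1U. Qed.

Lemma iterpolyC c : iterpoly c%:MP = c%:P%:P%:P.
Proof. by rewrite /iterpoly mmapC. Qed.

Lemma iterpolyZ c F : iterpoly (c *: F) = c%:P%:P%:P * iterpoly F.
Proof. by rewrite -mul_mpolyC rmorphM /= iterpolyC. Qed.

Lemma coef_iterpoly F i j k : (iterpoly F)`_j`_i`_k = F@_(mon i j k).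
Proof.
rewrite {1}(mpolyE F) rmorph_sum !coef_sum /=.
transitivity (\sum_(m <- msupp F) F@_m * (m == mon i j k)%:R); last first.
  by rewrite (big_msupp1 (m0 := mon i j k)) ?eqxx ?mulr1 // => m _ /negPf ->.
apply: eq_bigr => m _; rewrite iterpolyZ !coefCM; congr (_ * _).
have [iX iY iZ] := iterpoly_vars.
rewrite mpolyX3 !rmorphM !rmorphXn /= iX iY iZ -!rmorphXn /=.
rewrite mulrAC -!rmorphM /= coefCM coefXn mon_eqE.
rewrite [m 1 == _]eq_sym; case: eqP => _; last by rewrite mulr0 !coef0 andbF.
rewrite mulr1 coefMC coefXn [m 0 == _]eq_sym; case: eqP => _; last first.
  by rewrite mul0r coef0.
by rewrite mul1r coefXn eq_sym.
Qed.

Lemma iterpoly_inj : injective iterpoly.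
Proof.
move=> F G eFG; apply/mpolyP => m.
by rewrite (mon_eta m) -!coef_iterpoly eFG.
Qed.

(* Eisenstein's criterion at the prime 'X of R['X]; the reduction map is evaluation at 0. *)
Lemma eisensteinX (R : idomainType) (n : nat) (u : {poly R}) (g h : {poly {poly R}}) :
  (0 < n)%N -> u.[0] != 0 -> g * h = 'X^n - ('X * u)%:P ->
  size g = 1%N \/ size h = 1%N.
Proof.
move=> n_gt0 u0 gh; pose ev := map_poly (horner_eval (0 : R)).
(* If the constant coefficient of [g'] is nonzero, the coefficients of [h'] below [n] vanish one
   after another, so [h'] must reach degree [n]. *)
have low (g' h' : {poly R}) : g' * h' = 'X^n -> g'`_0 != 0 -> (n < size h')%N.
  move=> gh' g0; have h0 i : (i < n)%N -> h'`_i = 0.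
    elim/ltn_ind: i => i IH ltin; have := congr1 (fun p : {poly R} => p`_i) gh'.
    rewrite coefM coefXn (ltn_eqF ltin) big_ord_recl /= subn0 big1 => [|l _].
      by rewrite addr0 => /eqP; rewrite mulf_eq0 (negPf g0) => /eqP.
    by rewrite IH ?mulr0 // /bump leq0n; have := ltn_ord l; lia.
  rewrite ltnNge; apply/negP => sz_h.
  have := congr1 (fun p : {poly R} => p`_n) gh'.
  rewrite coefM coefXn eqxx big_ord_recl /= subn0 (nth_default 0 sz_h) big1 => [/eqP|l _].
    by rewrite mulr0 addr0 eq_sym oner_eq0.
  by rewrite h0 ?mulr0 // /bump leq0n; have := ltn_ord l; lia.
have sz_gh : size (g * h) = n.+1.
  by rewrite gh size_polyDl size_polyXn // size_polyN ltnS (leq_trans (size_polyC_leq1 _)).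
have nz_gh : g * h != 0 by rewrite -size_poly_gt0 sz_gh.
have [g_nz h_nz] : g != 0 /\ h != 0 by apply/andP; rewrite -negb_or -mulf_eq0.
have sz_eq : (size g + size h = n.+2)%N.
  have := size_mul g_nz h_nz; rewrite sz_gh.
  move: g_nz h_nz; rewrite -!size_poly_gt0.
  by case: (size g) (size h) => [//|a] [//|b] _ _; rewrite addSn addnS /= => <-.
have ev_gh : ev g * ev h = 'X^n.
  rewrite -rmorphM gh rmorphB /= map_polyXn map_polyC /= /horner_eval.
  by rewrite hornerM hornerX mul0r polyC0 subr0.
have sz_ev (p : {poly {poly R}}) : (size (ev p) <= size p)%N by exact: size_poly.
have gh0 : g`_0 * h`_0 = - ('X * u).
  by rewrite -coef0M gh coefB coefXn coefC; case: (n) n_gt0 => // n' _; rewrite sub0r.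
have ev0 (p : {poly {poly R}}) : (ev p)`_0 = (p`_0).[0] by rewrite coef_map.
(* If the constant coefficient of one factor does not vanish at 0, [low] gives the other factor the
   full degree [n], leaving degree 0 for the first. *)
have [g0|g0] := eqVneq ((g`_0).[0]) 0; last first.
  left; have := low _ _ ev_gh; rewrite ev0 => /(_ g0) lt_n.
  have := leq_trans lt_n (sz_ev h); move: g_nz; rewrite -size_poly_gt0; lia.
have [h0|h0] := eqVneq ((h`_0).[0]) 0; last first.
  right; have := low (ev h) (ev g); rewrite mulrC ev0 => /(_ ev_gh h0) lt_n.
  have := leq_trans lt_n (sz_ev g); move: h_nz; rewrite -size_poly_gt0; lia.
(* Otherwise ['X] divides both constant coefficients, so ['X ^ 2] divides ['X * u], against [u.[0]
   != 0]. *)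
have [/factor_theorem[r gr]] : root g`_0 0 by apply/eqP.
have [/factor_theorem[s hs]] : root h`_0 0 by apply/eqP.
move: gh0; rewrite gr hs subr0 => e.
have : 'X * (u + 'X * (r * s)) = 0 :> {poly R}.
  rewrite mulrDr -[X in X + _]opprK -e; ring.
move/eqP; rewrite mulf_eq0 polyX_eq0 /= => /eqP /(congr1 (fun p : {poly R} => p.[0])).
by rewrite hornerD hornerM hornerX mul0r addr0 horner0 => /eqP; rewrite (negPf u0).
Qed.

(** The product is monic in [Y], so a factor of [Y]-degree 0 is a unit of [K[Z][X]], that is, a
    nonzero constant. *)
Lemma unit_iterpoly F G n (v : {poly {poly K}}) :
  iterpoly (F * G) = 'X^n - v%:P -> (0 < n)%N -> size (iterpoly F) = 1%N -> mconst F.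
Proof.
rewrite rmorphM /= => FG n_gt0 /eqP/size_poly1P[r r_nz Fr].
have r1 : r * lead_coef (iterpoly G) = 1.
  rewrite -[r]lead_coefC -Fr -lead_coefM FG lead_coefDl ?lead_coefXn //.
  by rewrite size_polyN size_polyXn ltnS (leq_trans (size_polyC_leq1 _)).
have : r \is a GRing.unit by apply/unitrPr; exists (lead_coef (iterpoly G)).
rewrite poly_unitE => /andP[/eqP sz_r unit_r].
have /eqP/size_poly1P[s s_nz rs] := sz_r.
move: unit_r; rewrite rs coefC /= poly_unitE => /andP[/size_poly1P[c c_nz sc] _].
by exists c; apply: iterpoly_inj; rewrite iterpolyC Fr rs sc.
Qed.

Lemma mirreducible_eisenstein F n (u : {poly {poly K}}) :
  (0 < n)%N -> u.[0] != 0 -> iterpoly F = 'X^n - ('X * u)%:P -> mirreducible F.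
Proof.
move=> n_gt0 u0 eF; split=> [[c Fc]|G H FGH].
  move: eF; rewrite Fc iterpolyC => /(congr1 (fun p : {poly {poly {poly K}}} => size p)).
  rewrite size_polyDl size_polyXn ?size_polyN ?ltnS.
    by move=> e; have := size_polyC_leq1 (c%:P%:P : {poly {poly K}}); rewrite e; lia.
  exact: leq_trans (size_polyC_leq1 _) _.
have := eF; rewrite FGH rmorphM /= => eGH.
have [szG|szH] := eisensteinX n_gt0 u0 eGH; [left | right].
  by apply: (unit_iterpoly (G := H) _ n_gt0 szG); rewrite -FGH eF.
by apply: (unit_iterpoly (G := G) _ n_gt0 szH); rewrite mulrC -FGH eF.
Qed.

End Irreducibility.

(** * The invariant conic and the invariant curve of degree [q + 1] *)

Section InvariantCurves.
Variable K : fieldType.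
Implicit Types (F G H : {mpoly K[3]}).

Notation X := (Xv K). Notation Y := (Yv K). Notation Z := (Zv K).

Definition conic (l : K) : {mpoly K[3]} := Y ^+ 2 - l *: (X * Z).

(* [v |-> B(v, v^q)] for the bilinear form [B] polarizing the conic. *)
Definition hermitian_curve (q : nat) : {mpoly K[3]} :=
  Y ^+ q.+1 - (X * Z ^+ q + X ^+ q * Z).

Lemma homog_Xv : [/\ X \is 1.-homog, Y \is 1.-homog & Z \is 1.-homog].
Proof. by rewrite /Xv /Yv /Zv !dhomogX /= !mdeg1. Qed.

Lemma homog_conic l : conic l \is 2.-homog.
Proof.
have [hX hY hZ] := homog_Xv.
by rewrite rpredB ?rpredZ ?(dhomogM hX hZ) //; exact: (dhomogMn 2 hY).
Qed.

Lemma homog_hermitian q : hermitian_curve q \is q.+1.-homog.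
Proof.
have [hX hY hZ] := homog_Xv.
have h (P : {mpoly K[3]}) : P \is 1.-homog -> P ^+ q \is q.-homog.
  by move=> /(dhomogMn q); rewrite mul1n.
rewrite rpredB ?rpredD //.
- by have := dhomogMn q.+1 hY; rewrite mul1n.
- by have := dhomogM hX (h _ hZ); rewrite add1n.
- by have := dhomogM (h _ hX) hZ; rewrite addn1.
Qed.

Lemma form_of_homog_irr d F : F \is d.-homog -> mirreducible F -> is_form_of_degree d F.
Proof.
move=> homF [ncF _]; split=> //; apply/eqP => F0.
by apply: ncF; exists 0; rewrite F0 mpolyC0.
Qed.

Lemma conic_irr l : l != 0 -> mirreducible (conic l).
Proof.
move=> l0; have [iX iY iZ] := iterpoly_vars K.
apply: (@mirreducible_eisenstein _ _ 2 (l *: 'X)%:P) => //.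
  by rewrite hornerC scaler_eq0 negb_or l0 polyX_eq0.
rewrite /conic rmorphB rmorphXn /= iY iterpolyZ rmorphM /= iX iZ.
by congr (_ - _); rewrite -mul_polyC !polyCM mulrCA.
Qed.

Lemma hermitian_irr q : (1 < q)%N -> mirreducible (hermitian_curve q).
Proof.
move=> q_gt1; have [iX iY iZ] := iterpoly_vars K.
(* The witness is [Z ^ q + X ^ (q - 1) Z]; its value at [X = 0] is [Z ^ q] because [q > 1]. *)
apply: (@mirreducible_eisenstein _ _ q.+1 ('X^q%:P + 'X^(q.-1) * 'X%:P)) => //.
  rewrite hornerD hornerC hornerM hornerXn hornerC expr0n.
  by case: q q_gt1 => [|[|q]] // _; rewrite mul0r addr0 monic_neq0 ?monicXn.
rewrite /hermitian_curve rmorphB rmorphXn rmorphD !rmorphM !rmorphXn /= iX iY iZ.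
congr (_ - _); rewrite -!rmorphXn /= -!rmorphM -!rmorphD /=; congr (_%:P).
by rewrite mulrDr mulrA -exprS prednK // ltnW.
Qed.

Lemma invariant_generators q F :
  curve_invariant_by (tau_mx K) F ->
  (forall a, a ^+ q = a -> curve_invariant_by (sigma_mx a) F) ->
  (forall b, b ^+ q = b -> b != 0 -> curve_invariant_by (Defs.delta_mx b) F) ->
  G_invariant (in_PGL2 (K:=K) q) F.
Proof.
move=> tF sF dF M; elim=> {M} [|//|a|b|M N _ [c c0 McF] _ [c' c'0 NcF]].
- by exists 1; rewrite ?oner_neq0 // msubst1 scale1r.
- exact: sF.
- exact: dF.
- exists (c * c'); first by rewrite mulf_neq0.
  by rewrite msubstM McF msubstZ NcF scalerA.
Qed.

(** Writing [a = 2 h] turns [a ^ 2 / 2] into [2 h ^ 2]; no division is left and [ring] applies. *)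
Lemma sigma_halves a : 2%:R != 0 :> K -> let h := (a / 2%:R)%:MP_[3] in
  [/\ msubst (sigma_mx a) X = X + 2%:R * h * Y + 2%:R * h ^+ 2 * Z,
      msubst (sigma_mx a) Y = Y + 2%:R * h * Z & msubst (sigma_mx a) Z = Z].
Proof.
move=> nz2 /=; have [-> -> ->] := msubst_sigma_vars a; set h := a / _.
have -> : a = 2%:R * h by rewrite mulrC divfK.
have -> : (2%:R * h) ^+ 2 / 2%:R = 2%:R * h ^+ 2 by field.
by rewrite !expr2 -!mul_mpolyC !mpolyCM !rmorph_nat addrA.
Qed.

Lemma conic_invariant q : 2%:R != 0 :> K ->
  G_invariant (in_PGL2 (K:=K) q) (conic 2%:R).
Proof.
move=> nz2; apply: invariant_generators => [|a _|b _ b0].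
- have [tX tY tZ] := msubst_tau_vars K; exists 1; rewrite ?oner_neq0 // scale1r.
  by rewrite /conic rmorphB rmorphXn /= msubstZ rmorphM /= tX tY tZ (mulrC X).
- have [sX sY sZ] := sigma_halves a nz2; exists 1; rewrite ?oner_neq0 // scale1r.
  rewrite /conic rmorphB rmorphXn /= msubstZ rmorphM /= sX sY sZ.
  by rewrite -!mul_mpolyC !rmorph_nat; ring.
- have [dX dY dZ] := msubst_delta_vars b; exists (b ^+ 2); rewrite ?expf_neq0 //.
  rewrite /conic rmorphB rmorphXn /= msubstZ rmorphM /= dX dY dZ.
  by rewrite exprZn -!mul_mpolyC; ring.
Qed.

Lemma mpoly_frobenius p k F G : p \in [pchar K] ->
  (F + G) ^+ (p ^ k) = F ^+ (p ^ k) + G ^+ (p ^ k).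
Proof.
move=> pK; apply: exprDn_pchar; rewrite pnatX; apply/orP; left.
rewrite pnatE ?(pcharf_prime pK) //.
by rewrite (pchar_lalg {mpoly K[3]}).
Qed.

Lemma hermitian_invariant p k : p \in [pchar K] -> 2%:R != 0 :> K ->
  G_invariant (in_PGL2 (K:=K) (p ^ k)) (hermitian_curve (p ^ k)).
Proof.
move=> pK nz2; have frob := mpoly_frobenius k _ _ pK.
have frob2 : (2%:R : K) ^+ (p ^ k) = 2%:R.
  by elim: k {frob} => [|k IH]; rewrite ?expr1 // expnSr exprM IH; exact: pFrobenius_aut_nat.
(* From here on [q] is opaque: additivity of the [q]-th power and [2 ^ q = 2] are all that is
   retained. *)
move: (p ^ k)%N frob frob2 => q frob frob2.
apply: invariant_generators => [|a aq|b bq b0].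
- have [tX tY tZ] := msubst_tau_vars K; exists 1; rewrite ?oner_neq0 // scale1r.
  rewrite /hermitian_curve rmorphB rmorphD !rmorphM !rmorphXn /= tX tY tZ; ring.
- have [sX sY sZ] := sigma_halves a nz2; exists 1; rewrite ?oner_neq0 // scale1r.
  rewrite /hermitian_curve rmorphB rmorphD !rmorphM !rmorphXn /= sX sY sZ.
  have hq : (a / 2%:R)%:MP_[3] ^+ q = (a / 2%:R)%:MP_[3].
    by rewrite -rmorphXn /= exprMn exprVn frob2 aq.
  have frobP : (2%:R : {mpoly K[3]}) ^+ q = 2%:R.
    by rewrite -(rmorph_nat (@mpolyC 3 K)) -rmorphXn frob2.
  by rewrite !exprS !frob !exprMn frobP -exprM mulnC exprM hq; ring.
- have [dX dY dZ] := msubst_delta_vars b; exists (b ^+ 2); rewrite ?expf_neq0 //.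
  rewrite /hermitian_curve rmorphB rmorphD !rmorphM !rmorphXn /= dX dY dZ.
  rewrite !(exprS _ q) !exprZn (exprAC b 2 q) bq -!mul_mpolyC; ring.
Qed.

End InvariantCurves.

(** * The elements of [F_q] in an algebraically closed field *)

Section FiniteSubfield.
Variable K : closedFieldType.

(** The roots of [X ^ q - X] serve: its derivative is -1, so they are distinct. *)
Lemma exists_Fq q : (1 < q)%N -> q%:R = 0 :> K ->
  exists s : seq K, [/\ uniq s, size s = q & forall x, x \in s -> x ^+ q = x].
Proof.
move=> q_gt1 q0; pose P : {poly K} := 'X^q - 'X.
have szP : size P = q.+1.
  by rewrite size_polyDl size_polyXn // size_polyN size_polyX.
have monP : lead_coef P = 1.
  by rewrite lead_coefDl ?lead_coefXn // size_polyXn size_polyN size_polyX.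
have [s Ps] := closed_field_poly_normal P; rewrite monP scale1r in Ps.
exists s; split.
- rewrite -separable_prod_XsubC -Ps unlock derivB derivXn derivX.
  rewrite -mulr_natl -polyC_natr q0 polyC0 mul0r sub0r -scaleN1r.
  by rewrite coprimepZr ?oppr_eq0 ?oner_neq0 // coprimep1.
- by apply: succn_inj; rewrite -szP Ps size_prod_XsubC.
- move=> x xs; apply/eqP; rewrite -subr_eq0.
  by have : root P x; [rewrite Ps root_prod_XsubC | rewrite /root !hornerE].
Qed.

(** Every nonzero element of [F_q] is a root of [X ^ t - 1], and there are at least [q - 1] of
    them. *)
Lemma Fq_exponent q t : (1 < q)%N -> q%:R = 0 :> K -> (0 < t)%N ->
  (forall b : K, b ^+ q = b -> b != 0 -> b ^+ t = 1) -> (q.-1 <= t)%N.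
Proof.
move=> q_gt1 q0 t_gt0 tP; have [s [us szs sP]] := exists_Fq q_gt1 q0.
have szQ := size_Xn_sub_1 K t_gt0.
have: (size (rem 0%R s) < size ('X^t - 1 : {poly K})%R)%N.
  apply: max_poly_roots; rewrite ?rem_uniq -?size_poly_gt0 ?szQ //.
  apply/allP => b; rewrite (rem_filter _ us) mem_filter /= => /andP[b0 /sP bq].
  have bt : b ^+ t = 1 by apply: tP.
  by rewrite /root hornerD hornerN hornerXn hornerC bt subrr.
rewrite szQ ltnS; apply: leq_trans; rewrite -szs.
(* Removing 0 costs at most one element of [s]. *)
have [/size_rem -> //|/rem_id -> //] := boolP (0 \in s); exact: leq_pred.
Qed.

Lemma Fq_expr_eq q i j : (1 < q)%N -> q%:R = 0 :> K -> (i < j)%N ->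
  (forall b : K, b ^+ q = b -> b != 0 -> b ^+ i = b ^+ j) -> (q.-1 <= j - i)%N.
Proof.
move=> q_gt1 q0 lt_ij ijP; apply: Fq_exponent => // [|b bq b0]; first by rewrite subn_gt0.
apply: (mulfI (expf_neq0 i b0)).
by rewrite -exprD subnKC ?mulr1 1?ltnW // -ijP.
Qed.

(** A single root would yield [q] distinct translates, too many for a nonzero polynomial of degree
    below [q]. *)
Lemma shift_invariant_const q (P : {poly K}) : (1 < q)%N -> q%:R = 0 :> K ->
  (size P <= q)%N -> (forall a x : K, a ^+ q = a -> root P x -> root P (x + a)) ->
  (size P <= 1)%N.
Proof.
move=> q_gt1 q0 szP shiftP; have [->//|nszP] := eqVneq (size P) 1%N.
have /closed_rootP[x Px] := nszP.
have [s [us szs sP]] := exists_Fq q_gt1 q0.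
have [->|P0] := eqVneq P 0; first by rewrite size_poly0.
suff: (q < size P)%N by rewrite ltnNge szP.
rewrite -szs -(size_map (fun a => x + a) s); apply: max_poly_roots => //.
  by apply/allP => _ /mapP[a /sP aq ->]; apply: shiftP.
by rewrite map_inj_uniq //; exact: addrI.
Qed.

End FiniteSubfield.

(** * Splitting off factors of an irreducible form *)

Section Factors.
Variable K : fieldType.
Implicit Types (F G H : {mpoly K[3]}).

Notation X := (Xv K). Notation Y := (Yv K). Notation Z := (Zv K).

(** The points [v] and [w] certify that [G] is not constant, so the cofactor is. *)
Lemma mirreducible_factor F G H v w :
  mirreducible F -> F = G * H -> G.@[v] != G.@[w] -> exists2 c, c != 0 & F = c *: G.
Proof.
move=> [ncF /(_ G H) irrF] FGH nvw.
case: (irrF FGH) => [[c Gc]|[c Hc]].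
  by move: nvw; rewrite Gc !mevalC eqxx.
exists c; last by rewrite FGH Hc mulrC mul_mpolyC.
by apply: contra_not_neq ncF => c0; exists 0; rewrite FGH Hc c0 mpolyC0 mulr0.
Qed.

(* The form obtained from [g] by homogenizing in the two conics [Y ^ 2] and [X Z]. *)
Definition pencil_form n (g : {poly K}) : {mpoly K[3]} :=
  \sum_(i < n.+1) g`_i *: ((Y ^+ 2) ^+ i * (X * Z) ^+ (n - i)).

(** Through this identity each root [l] of the univariate polynomial yields a conic dividing the
    form. *)
Lemma pencil_formM n (g : {poly K}) (l : K) : (size g <= n.+1)%N ->
  pencil_form n.+1 (g * ('X - l%:P)) = conic l * pencil_form n g.
Proof.
move=> szg; rewrite /pencil_form /conic mulrBl !mulr_sumr.
under eq_bigr => i _ do rewrite mulrBr coefB coefMX coefMC scalerBl.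
rewrite sumrB big_ord_recl /= scale0r add0r; congr (_ - _).
  apply: eq_bigr => i _; rewrite /bump leq0n add1n subSS exprS.
  by rewrite -scalerAr mulrA.
rewrite big_ord_recr /= nth_default // mul0r scale0r addr0.
apply: eq_bigr => i _; rewrite subSn 1?(exprS (X * Z)); last by rewrite -ltnS.
rewrite -!scalerAr -!scalerAl scalerA; congr (_ *: _).
by rewrite mulrCA.
Qed.

(** With equal exponents of [X] and [Z], every monomial of degree [2 n] is some
    [Y ^ (2 i) (X Z) ^ (n - i)]. *)
Lemma pencil_form_supp n F : F \is (n.*2).-homog ->
  (forall m, m \in msupp F -> m 0%R = m 2%R) ->
  F = pencil_form n (\poly_(i < n.+1) F@_(mon (n - i) i.*2 (n - i))).
Proof.
move=> homF suppF; apply/mpolyP => m; rewrite raddf_sum /=.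
have E (i : 'I_n.+1) : (Y ^+ 2) ^+ i * (X * Z) ^+ (n - i) = 'X_[mon (n - i) i.*2 (n - i)].
  by rewrite mpolyX_mon -exprM mul2n exprMn; ring.
under eq_bigr => i _ do rewrite E mcoeffZ mcoeffX coef_poly ltn_ord.
have [mF|mF] := boolP (m \in msupp F); last first.
  rewrite big1 ?memN_msupp_eq0 // => i _.
  by case: eqP => [->|]; rewrite ?mulr0 ?memN_msupp_eq0 ?mul0r.
have m02 := suppF _ mF; have dm := homog_deg homF mF.
have lt_m : ((m 1%R)./2 < n.+1)%N by lia.
have em : mon (n - (m 1%R)./2) (m 1%R)./2.*2 (n - (m 1%R)./2) = m.
  by apply/esym/eqP; rewrite mon_eqE; apply/and3P; split; apply/eqP; lia.
rewrite (bigD1 (Ordinal lt_m)) //= em eqxx mulr1 big1 ?addr0 // => i ne_i.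
have [e|_] := eqVneq; last by rewrite mulr0.
case/eqP: ne_i; apply: val_inj => /=; rewrite -e mon1; lia.
Qed.

End Factors.

(** * Invariant irreducible forms of degree at most [q] *)

Section LowDegree.
Variables (K : closedFieldType) (q d : nat) (F : {mpoly K[3]}).
Hypotheses (q_gt2 : (2 < q)%N) (q0 : q%:R = 0 :> K) (nz2 : 2%:R != 0 :> K).
Hypotheses (homF : F \is d.-homog) (le_dq : (d <= q)%N).
Hypotheses (irrF : mirreducible F) (invF : G_invariant (in_PGL2 (K:=K) q) F).

Notation X := (Xv K). Notation Y := (Yv K). Notation Z := (Zv K).

Let q_gt1 : (1 < q)%N. Proof. exact: ltnW. Qed.

Lemma inv_tau : exists2 c, c != 0 &
  forall x y z, F.@[pt z y x] = c * F.@[pt x y z].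
Proof.
have [c c0 cF] := invF (PGL2_tau K q); exists c => // x y z.
by rewrite -meval_tau cF mevalZ.
Qed.

Lemma inv_sigma (a : K) : a ^+ q = a -> exists2 c, c != 0 &
  forall x y z, F.@[pt (x + a * y + a ^+ 2 / 2%:R * z) (y + a * z) z] = c * F.@[pt x y z].
Proof.
move=> aq; have [c c0 cF] := invF (PGL2_sigma aq); exists c => // x y z.
by rewrite -meval_sigma cF mevalZ.
Qed.

(** Keeping only the vanishing discards the unknown scalar. *)
Lemma sigma1_eq0 x y z :
  (F.@[pt (x + y + z / 2%:R) (y + z) z] == 0) = (F.@[pt x y z] == 0).
Proof.
have [c c0 /(_ x y z)] := inv_sigma (expr1n K q).
by rewrite !mul1r expr1n mul1r mulrC => ->; rewrite mulf_eq0 (negPf c0).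
Qed.

Lemma tau_eq0 x y z : (F.@[pt z y x] == 0) = (F.@[pt x y z] == 0).
Proof. by have [c c0 ->] := inv_tau; rewrite mulf_eq0 (negPf c0). Qed.

Lemma mcoeff_tau_eq0 i j k : (F@_(mon k j i) == 0) = (F@_(mon i j k) == 0).
Proof.
have [c c0 cF] := invF (PGL2_tau K q).
by rewrite -mcoeff_tau cF mcoeffZ mulf_eq0 (negPf c0).
Qed.

(** Both sides equal the scalar by which [delta_b] multiplies [F]. *)
Lemma supp_delta m m' (b : K) : b ^+ q = b -> b != 0 -> m \in msupp F -> m' \in msupp F ->
  b ^+ (m 0%R).*2 * b ^+ m 1%R = b ^+ (m' 0%R).*2 * b ^+ m' 1%R.
Proof.
move=> bq b0; rewrite !mcoeff_msupp => mF m'F.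
have [c c0 cF] := invF (PGL2_delta bq b0).
apply: (mulIf mF); rewrite -mcoeff_delta cF mcoeffZ; congr (_ * _).
by apply: (mulIf m'F); rewrite -mcoeff_delta cF mcoeffZ.
Qed.

(** The root set of the restriction is stable under translations by [F_q], so the restriction is
    constant: among the monomials free of [Z] only [Y ^ d] can survive. *)
Lemma tangent_const : (size (tangent d F) <= q)%N ->
  forall i j, (0 < i)%N -> F@_(mon i j 0) = 0.
Proof.
move=> szT i j i_gt0; have sz1 : (size (tangent d F) <= 1)%N.
  apply: shift_invariant_const szT _ => // a x aq.
  rewrite /root !tangentE //; have [c c0 /(_ x 1 0)] := inv_sigma aq.
  by rewrite !mulr0 !addr0 mulr1 => -> /eqP ->; rewrite mulr0.
have [ij|ij] := eqVneq (i + j)%N d; last first.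
  apply: memN_msupp_eq0; apply: contraNN ij => /(homog_deg homF).
  by rewrite mon0 mon1 mon2 addn0 => ->.
have := nth_default 0 (leq_trans sz1 i_gt0).
rewrite coef_poly (_ : (i < d.+1)%N); last by rewrite ltnS -ij leq_addr.
by rewrite -ij addKn.
Qed.

(** Irreducibility would make [F] a multiple of [Z], which [tau] sends to [X]. *)
Lemma not_dvd_Z : ~ (forall m, m \in msupp F -> (0 < m 2%R)%N).
Proof.
move=> /mvar_dvd[H FH].
have [|c c0 Fc] := mirreducible_factor (v := pt 0 0 0) (w := pt 0 0 1) irrF FH.
  by rewrite !mevalXU /pt /= eq_sym oner_neq0.
have := tau_eq0 1 0 0; rewrite Fc !mevalZ !mevalXU /pt /= mulr0 mulr1 eqxx.
by rewrite (negPf c0).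
Qed.

(** Irreducibility would make [F] a multiple of [Y], which [sigma_1] sends to [Y + Z]. *)
Lemma not_dvd_Y : ~ (forall m, m \in msupp F -> (0 < m 1%R)%N).
Proof.
move=> /mvar_dvd[H FH].
have [|c c0 Fc] := mirreducible_factor (v := pt 0 0 0) (w := pt 0 1 0) irrF FH.
  by rewrite !mevalXU /pt /= eq_sym oner_neq0.
have := sigma1_eq0 0 0 1; rewrite Fc !mevalZ !mevalXU /pt /= add0r mulr0 mulr1 eqxx.
by rewrite (negPf c0).
Qed.

Lemma conic_of_pencil n : d = n.*2 -> (forall m, m \in msupp F -> m 0%R = m 2%R) ->
  F@_(mon 0 d 0) != 0 -> exists2 c : K, c != 0 & F = c *: conic 2%:R.
Proof.
move=> d2 suppF Y_neq0; have FE := @pencil_form_supp K n F.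
move: FE; rewrite -d2 => /(_ homF suppF); set g := \poly_(_ < _) _ => FE.
have gn : g`_n != 0 by rewrite coef_poly ltnSn subnn -d2.
have szg : size g = n.+1.
  apply/eqP; rewrite eqn_leq size_poly ltnNge; apply: contra gn => szg.
  by rewrite nth_default.
case: n => [|n] in d2 g FE gn szg *.
  case: irrF => ncF _; case: ncF; exists g`_0.
  by rewrite FE /pencil_form big_ord1 subn0 !expr0 mulr1 alg_mpolyC.
have [|l] := @closed_rootP _ g _; first by rewrite szg.
case/factor_theorem => h gh.
have szh : (size h <= n.+1)%N.
  have := szg; rewrite gh size_Mmonic ?monicXsubC ?size_XsubC ?addn2 //=.
    by case=> ->.
  by apply: contraTneq gn => h0; rewrite gh h0 mul0r coef0 eqxx.
move: FE; rewrite gh pencil_formM // => FE.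
have conicE x y z : (conic l).@[pt x y z] = y ^+ 2 - l * (x * z).
  by rewrite mevalB mevalZ !expr2 !mevalM !mevalXU.
have [|c c0 Fc] := mirreducible_factor (v := pt 0 0 0) (w := pt 0 1 0) irrF FE.
  by rewrite !conicE mulr0 mulr0 !subr0 expr1n expr0n eq_sym oner_neq0.
(* The point [(0 : 0 : 1)] lies on [conic l]; its image [(1/2 : 1 : 1)] does so only if
   [1 = l / 2]. *)
have := sigma1_eq0 0 0 1; rewrite Fc !mevalZ !conicE !add0r !(mul0r, mulr0) subr0.
rewrite expr0n mulr0 eqxx mulf_eq0 (negPf c0) /= expr1n mulr1 div1r subr_eq0.
move=> /eqP l2; exists c => //; congr (_ *: conic _).
by apply: (mulIf (invr_neq0 nz2)); rewrite mulfV.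
Qed.

Lemma low_degree_tangent : (size (tangent d F) <= q)%N ->
  exists2 c : K, c != 0 & F = c *: conic 2%:R.
Proof.
move=> /tangent_const Ti0; have [Y0|Y0] := eqVneq (F@_(mon 0 d 0)) 0.
  (* With [Y ^ d] absent as well, every monomial would contain [Z]. *)
  case: not_dvd_Z => m mF; rewrite lt0n; apply/eqP => m2.
  have dm := homog_deg homF mF; move: mF; rewrite mcoeff_msupp (mon_eta m) m2.
  have [m0|m0] := posnP (m 0%R); last by rewrite Ti0 ?eqxx.
  by rewrite m0 (_ : m 1%R = d) ?Y0 ?eqxx //; lia.
(* Comparison with [Y ^ d]: cancelling in [b ^ (2 m0 + m1) = b ^ (m0 + m1 + m2)] leaves the
   exponents of [X] and [Z]. *)
have suppXZ m (b : K) : m \in msupp F -> b ^+ q = b -> b != 0 -> b ^+ m 0%R = b ^+ m 2%R.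
  move=> mF bq b0; have YF : mon 0 d 0 \in msupp F by rewrite mcoeff_msupp.
  have := supp_delta bq b0 mF YF; rewrite mon0 mon1 -(homog_deg homF mF) mul1r.
  rewrite -addnn !exprD -!mulrA => /(mulfI (expf_neq0 _ b0)).
  by rewrite mulrC => /(mulfI (expf_neq0 _ b0)).
have suppF m : m \in msupp F -> m 0%R = m 2%R.
  move=> mF; have dm := homog_deg homF mF.
  have [m0|m2|//] := ltngtP (m 0%R) (m 2%R).
    (* The gap is at least [q - 1]. If the smaller exponent is positive, the degree exceeds [q]; if
       it is 0, the monomial or its mirror image under [tau] is free of [Z] and excluded by
       [Ti0]. *)
    have := Fq_expr_eq q_gt1 q0 m0 (fun b => suppXZ m b mF).
    have [e|m0_gt0] := posnP (m 0%R); last by lia.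
    move: mF; rewrite mcoeff_msupp (mon_eta m) e mcoeff_tau_eq0 Ti0 ?eqxx //; lia.
  have := Fq_expr_eq q_gt1 q0 m2 (fun b bq b0 => esym (suppXZ m b mF bq b0)).
  have [e|m2_gt0] := posnP (m 2%R); last by lia.
  by move: mF; rewrite mcoeff_msupp (mon_eta m) e Ti0 ?eqxx //; lia.
(* For odd [d] the exponent of [Y] is odd in every monomial, so [Y] would divide [F]. *)
have [odd_d|even_d] := boolP (odd d).
  case: not_dvd_Y => m mF; have := homog_deg homF mF; have := suppF m mF; lia.
by apply: (conic_of_pencil (n := d./2)) => //; lia.
Qed.

(* The exceptional case: here [q = 3], and the form would be a product of three lines. *)
Lemma full_tangent_absurd : d = q -> F@_(mon d 0 0) != 0 -> False.
Proof.
move=> dq X0; have Z0 : F@_(mon 0 0 d) != 0 by rewrite mcoeff_tau_eq0.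
have q3 : q = 3%N.
  (* [delta_b] scales [X ^ q] by [b ^ (2 q) = b ^ 2] and fixes [Z ^ q], so [b ^ 2 = 1] for every
     nonzero [b] in [F_q]. *)
  have : (q.-1 <= 2)%N; last by lia.
  apply: (Fq_exponent q_gt1 q0) => // b bq b0.
  have XF : mon d 0 0 \in msupp F by rewrite mcoeff_msupp.
  have ZF : mon 0 0 d \in msupp F by rewrite mcoeff_msupp.
  have := supp_delta bq b0 XF ZF; rewrite !mon0 !mon1 !expr0 !mulr1 dq => <-.
  by rewrite -mul2n mulnC exprM bq.
have three0 : 3%:R = 0 :> K by rewrite -q3.
have half : 2%:R^-1 = -1 :> K.
  by apply: (mulfI nz2); rewrite mulfV // -[LHS]subr0 -three0; ring.
have N1q : (-1) ^+ q = -1 :> K by rewrite q3; ring.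
have nz1 : (-1 : K) != 0 by rewrite oppr_eq0 oner_neq0.
(* [delta_b] at [b = -1] fixes the monomial [Z ^ d] of [F], so its scalar is 1. *)
have evenF x y z : F.@[pt x (- y) z] = F.@[pt x y z].
  have [c c0 cF] := invF (PGL2_delta N1q nz1).
  have c1 : c = 1.
    apply: (mulIf Z0); rewrite -mcoeffZ -cF mcoeff_delta mon0 mon1.
    by rewrite !expr0 !mul1r.
  have := meval_delta (-1) F x y z; rewrite cF c1 scale1r => ->.
  by congr (_.@[pt _ _ _]); ring.
(* In characteristic 3 this point is [(1/2 : 1 : 1)], the image of [(0 : 0 : 1)] under [sigma_1]. *)
have v0 : F.@[pt (-1) 1 1] != 0.
  have := sigma1_eq0 0 0 1; rewrite !add0r mul1r half => ->.
  by rewrite (meval_Z homF).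
have [s s0 cF] := invF (PGL2_tau K q).
(* By evenness in [Y], the value at [(1, 1, -1)] is that at [(1, -1, -1)], the negative of
   [(-1, 1, 1)]; the odd degree gives the sign. *)
have sN1 : s = -1.
  apply: (mulIf v0); rewrite -mevalZ -cF meval_tau -evenF.
  have := meval_scale (-1) (-1) 1 1 homF; rewrite dq N1q mulrNN !mulr1 => <-.
  by [].
(* Here [tau] negates [F], so [X - Z] divides [-2 F]. *)
have [H] := msubst_tau_sub F; rewrite cF sN1 => FH.
have {}FH : F = (X - Z) * ((- 2%:R^-1) *: H).
  rewrite -scalerAr -FH scaleN1r -opprD scaleNr scalerN opprK -mulr2n.
  by rewrite -scaler_nat scalerA mulVf ?scale1r.
have [|c c0 Fc] := mirreducible_factor (v := pt 0 0 0) (w := pt 1 0 0) irrF FH.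
  by rewrite !mevalB !mevalXU /pt /= !subr0 eq_sym oner_neq0.
(* [sigma_1] moves [(0 : 1 : 0)], a point of the line [X = Z], to [(1 : 1 : 0)], off that line. *)
have := sigma1_eq0 0 1 0; rewrite Fc !mevalZ !mevalB !mevalXU /pt /=.
by rewrite mul0r !addr0 add0r !subr0 mulr0 mulr1 eqxx (negPf c0).
Qed.

Lemma low_degree : exists2 c : K, c != 0 & F = c *: conic 2%:R.
Proof.
(* Without [X ^ d] the restriction has size at most [d]; with it, [d = q] is excluded and the size
   is at most [d + 1]. Both are at most [q]. *)
have [X0|/full_tangent_absurd X0] := eqVneq F@_(mon d 0 0) 0.
  apply: low_degree_tangent; apply/leq_sizeP => j le_qj; rewrite coef_poly.
  case: ltnP => // lt_jd; have -> : j = d by lia.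
  by rewrite subnn X0.
apply: low_degree_tangent; apply: leq_trans (size_poly _ _) _.
rewrite ltn_neqAle le_dq andbT; apply/eqP => /X0; exact.
Qed.

End LowDegree.

Theorem mainTheorem13 (K : closedFieldType) (p k : nat) :
  prime p -> odd p -> (0 < k)%N -> (p \in [pchar K])%R ->
  (* K is an algebraic closure of F_q, i.e. algebraic over F_p *)
  (forall x : K, exists m : nat, (0 < m)%N /\ x ^+ (p ^ m) = x) ->
  let q := (p ^ k)%N in
  let G := in_PGL2 (K:=K) q in
  let C : {mpoly K[3]} := Yv K ^+ 2 - 2%:R *: (Xv K * Zv K) in
  [/\ d_of G 2, eps_of G (q - 1)%N &
      (* the conic C is the unique invariant irreducible curve of degree < q+1 *)
      [/\ is_form_of_degree 2 C, mirreducible C, G_invariant G C &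
          forall (d : nat) (F : {mpoly K[3]}),
            (d < q + 1)%N -> is_form_of_degree d F -> mirreducible F ->
            G_invariant G F -> exists2 c : K, c != 0 & F = c *: C]].
Proof.
move=> p_pr p_odd k_gt0 pK _ q G C.
have p_gt2 : (2 < p)%N by apply: odd_prime_gt2.
have q_gt2 : (2 < q)%N.
  by apply: leq_trans p_gt2 _; rewrite -{1}[p]expn1 leq_exp2l // prime_gt1.
have nz2 : 2%:R != 0 :> K.
  rewrite -(dvdn_pcharf pK); apply/negP => /dvdn_leq; lia.
have q0 : q%:R = 0 :> K.
  by rewrite natrX (pcharf0 pK) expr0n; case: k k_gt0 {q G q_gt2}.
have uniqC d F : (d < q + 1)%N -> is_form_of_degree d F -> mirreducible F ->
    G_invariant G F -> exists2 c : K, c != 0 & F = c *: C.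
  rewrite addn1 ltnS => le_dq [_ homF] irrF invF.
  exact: low_degree q_gt2 q0 nz2 homF le_dq irrF invF.
have irrC : mirreducible C := conic_irr nz2.
have formC : is_form_of_degree 2 C := form_of_homog_irr (homog_conic _) irrC.
have invC : G_invariant G C := conic_invariant nz2.
(* A nonzero form has only one degree, so uniqueness of the curve settles both minimality claims. *)
have deg2 d : (d < q + 1)%N -> has_inv_irr_curve G d -> d = 2%N.
  move=> lt_dq [F [formF irrF invF]]; have [c c0 Fc] := uniqC d F lt_dq formF irrF invF.
  case: formF => F0 homF; apply: dhomog_uniq F0 homF _.
  by rewrite Fc rpredZ //; case: formC.
have d2 : d_of G 2.
  split=> // [|m lt_m2 _ invm]; first by exists C.
  by have m2 := deg2 m (ltn_trans lt_m2 (ltn_addr 1 q_gt2)) invm; rewrite m2 in lt_m2.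
(* The next degree [q + 1] is attained by [hermitian_curve]. *)
split=> //; exists 2%N, (q + 1)%N; split=> //; last by lia.
have irrH : mirreducible (hermitian_curve K q) by apply: hermitian_irr; lia.
split=> [||m /andP[lt2 ltq] /(deg2 _ ltq) m2]; [lia | | by move: lt2; rewrite m2].
exists (hermitian_curve K q); split=> //; last exact: hermitian_invariant.
by rewrite addn1; apply: form_of_homog_irr irrH; exact: homog_hermitian.
Qed.
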